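(* Let $k$ be an algebraically closed field of characteristic zero and let $X=X_\Sigma$ be a quasiprojective simplicial normal toric variety over $k$ such that $\Sigma$ has full-dimensional convex support. Let $S=\operatorname{Cox}(X)$, graded by $D=\operatorname{Cl}(X)$, and let $\chi=\chi^a\in\widehat G$ be a character with $\chi\otimes 1\in C_\beta$. Then $\chi^a$ is generic if and only if $$B(\chi^a)=\big(f\in \operatorname{Gen}^D(S)\mid a\in \mathcal C_D(f)\big)\subseteq S$$ as ideals of $S$. In particular, the chamber $\sigma_a$ in the secondary fan containing $a$ is given by $$\sigma_a=\bigcap_{\substack{f\in\operatorname{Gen}^D(S)\\ a\in\mathcal C_D(f)}}\mathcal C_D(f).$$
   Context: Full-dimensional convex support: $|\Sigma|\subseteq N_{\mathbb R}$ is convex with $\dim|\Sigma|=\dim N_{\mathbb R}$. Then $S=k[x_1,\dots,x_n]$, one variable for each ray of $\Sigma$, graded by $D=\operatorname{Cl}(X)$. Put $G=\operatorname{Spec}(k[\operatorname{Cl}(X)])$, with character group $\widehat G\cong\operatorname{Cl}(X)$. There is an exact sequence $0\to M\xrightarrow{\delta}\mathbb Z^n\xrightarrow{\gamma}\widehat G\to0$, with $\beta_i=\gamma(e_i)=\deg(x_i)$; dually $\nu_i\in N=M^*$ are the images of the standard basis vectors under $\delta^*:\mathbb Z^n\to N$ (the ray generators of $\Sigma$). For $a\in\mathbb Z^n$, $\chi^a:=\gamma(a)$; in conditions such as $a\in\mathcal C_D(f)$, $a$ is identified with the image $\chi^a\otimes1$ of its class in $\widehat G_{\mathbb R}=\operatorname{Cl}(X)_{\mathbb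 R}$. $C_\beta=\operatorname{Cone}(\beta_1,\dots,\beta_n)\subseteq\widehat G_{\mathbb R}$. Generic: $\chi\in\widehat G$ is generic if $\chi\otimes1\in C_\beta$ and $\chi\otimes1\notin\operatorname{Cone}(\beta')$ for every $\beta'\subseteq\{\beta_1,\dots,\beta_n\}$ with $\dim\operatorname{Cone}(\beta')<\dim C_\beta=\dim G$. Irrelevant ideal of $\chi$: $P_\chi=\{b\in\mathbb R^n_{\ge0}\mid\gamma_{\mathbb R}(b)=\chi\otimes1\}$, $F_{i,\chi}=P_\chi\cap\{b_i=0\}$, and $B(\chi)=\big(\prod_{i\notin I}x_i\mid I\subseteq\{1,\dots,n\},\ \bigcap_{i\in I}F_{i,\chi}\ne\emptyset\big)$ (the empty intersection being $P_\chi$). Relevance: a homogeneous $f\in S$ is relevant if the group of degrees of homogeneous units of $S_f$ has finite index in $D$. $S_+$ is the ideal generated by all relevant elements. $\operatorname{Gen}^D(S)$ is the generating set of $S_+$ consisting of the monomic relevant elements, i.e. the relevant elements $\prod_{i\in I}x_i$ with $|I|=\operatorname{rank}(D)$. The weight cone of a homogeneous $f$ is $\mathcal C_D(f)=\overline{\operatorname{Cone}}(\{\deg(g)\mid g$ is a homogeneous divisor of $f^k$ for some $k\ge0\})\subseteq D_{\mathbb R}$. Secondary fan: for $a\in\mathbb Z^n$ with $\chi^a\otimes 1\in C_\beta$ let $P_a=\{m\in M_{\mathbb R}\mid\langle m,\nu_i\rangle\ge-a_i\ \forall i\}$, let $\Sigma_a$ be its normal fan (a generalized fan: cones need not be strongly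 convex) and $I_\emptyset=\{i\mid\{m\in P_a:\langle m,\nu_i\rangle=-a_i\}=\emptyset\}$. For such a pair $(\Sigma',I_\emptyset)$ let $\widetilde\Gamma_{\Sigma',I_\emptyset}$ be the set of $(a_1,\dots,a_n)\in\mathbb R^n$ for which there is a convex support function $\varphi$ on $\Sigma'$ (linear on each cone, with $\varphi(tu+(1-t)v)\ge t\varphi(u)+(1-t)\varphi(v)$ for $t\in[0,1]$) with $\varphi(\nu_i)=-a_i$ for $i\notin I_\emptyset$ and $\varphi(\nu_i)\ge-a_i$ for $i\in I_\emptyset$. The GKZ cone is $\Gamma_{\Sigma',I_\emptyset}=\widetilde\Gamma_{\Sigma',I_\emptyset}/\ker(\gamma_{\mathbb R})\subseteq\widehat G_{\mathbb R}$. The GKZ cones form the secondary fan of $X$, with support $C_\beta$; its chambers are its maximal (full-dimensional) cones. *)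

(* Defs.v *)
From HB Require Import structures.
From mathcomp Require Import all_boot all_order all_algebra.
From mathcomp Require Import boolp classical_sets cardinality reals topology.
From mathcomp Require Import normedtype convex.
(* The notations of mpoly clash with those of MathComp-Analysis; without them,
   {mpoly k[n]} is written mpoly n k and U_(i) is written mnm1 i. *)
From mathcomp Require Import -(notations) mpoly.

Set Implicit Arguments.
Unset Strict Implicit.
Unset Printing Implicit Defensive.

Import Order.TTheory GRing.Theory Num.Theory.
Import numFieldNormedType.Exports.

Local Open Scope classical_set_scope.
Local Open Scope ring_scope.
Local Open Scope quotient_scope.

Section Cones.
Variable R : realType.

Definition cone (V : lmodType R) (A : set V) : set V :=
  [set x | exists m (c : 'I_m -> R) (v : 'I_m -> V),
     [/\ forall i, 0 <= c i, forall i, A (v i) & x = \sum_i c i *: v i]].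

(* The dimension of the linear span of A, as the maximal number of linearly
   independent elements of A. *)
Definition cone_dim (r : nat) (A : set 'rV[R]_r) : nat :=
  \max_(m < r.+1 | `[< exists B : 'M[R]_(m, r),
                         row_free B /\ forall i, A (row i B) >]) m.

Definition toR (r : nat) (v : 'rV[int]_r) : 'rV[R]_r := map_mx intr v.

End Cones.

Arguments toR R {r} v.

(* The lattices are N = M = Z^d, in duality through the standard pairing. *)
Section Fans.
Variables (R : realType) (d : nat).
Implicit Types (sigma tau : set 'rV[R]_d) (Sigma : set (set 'rV[R]_d)).

Definition pairing (m u : 'rV[R]_d) : R := \sum_i m 0 i * u 0 i.

Definition rational_polyhedral sigma :=
  exists m (u : 'I_m -> 'rV[int]_d), sigma = cone (range (fun i => toR R (u i))).

Definition strongly_convex sigma := forall u, sigma u -> sigma (- u) -> u = 0.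

Definition face tau sigma :=
  exists m, (forall u, sigma u -> 0 <= pairing m u) /\
            tau = sigma `&` [set u | pairing m u = 0].

Definition is_fan Sigma :=
  [/\ finite_set Sigma, Sigma !=set0,
      forall sigma, Sigma sigma -> rational_polyhedral sigma /\ strongly_convex sigma,
      forall sigma tau, Sigma sigma -> face tau sigma -> Sigma tau
    & forall sigma tau, Sigma sigma -> Sigma tau ->
        face (sigma `&` tau) sigma /\ face (sigma `&` tau) tau].

Definition fan_support Sigma : set 'rV[R]_d := \bigcup_(sigma in Sigma) sigma.

Definition simplicial Sigma :=
  forall sigma, Sigma sigma -> exists m (B : 'M[R]_(m, d)),
    row_free B /\ sigma = cone (range (fun i => row i B)).

Definition primitive (v : 'rV[int]_d) :=
  forall (c : int) (w : 'rV[int]_d), v = c *: w -> `|c| = 1.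

(* The rows of nu are the ray generators of Sigma, each listed once. *)
Definition ray_generators Sigma (n : nat) (nu : 'M[int]_(n, d)) :=
  [/\ injective (fun i => row i nu), forall i, primitive (row i nu)
    & forall rho, (Sigma rho /\ cone_dim rho = 1%N) <->
                  exists i, rho = cone [set toR R (row i nu)]].

Definition full_dim_convex_support Sigma :=
  convex_set (fan_support Sigma) /\ cone_dim (fan_support Sigma) = d.

(* phi is only meant on the support of Sigma.  "Convex" is the toric convention:
   such a phi is concave in the usual sense. *)
Definition convex_support_function Sigma (phi : 'rV[R]_d -> R) :=
  (forall sigma, Sigma sigma ->
     exists m, forall u, sigma u -> phi u = pairing m u) /\
  (forall u v (t : R), fan_support Sigma u -> fan_support Sigma v -> 0 <= t <= 1 ->
     t * phi u + (1 - t) * phi v <= phi (t *: u + (1 - t) *: v)).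

(* Toric criterion for the existence of an ample Cartier divisor on X_Sigma,
   valid when Sigma has full-dimensional convex support: there is a convex
   support function, integral with respect to N, which on every d-dimensional
   cone sigma coincides with its linear form m_sigma exactly on sigma. *)
Definition quasiprojective Sigma :=
  exists phi : 'rV[R]_d -> R,
    [/\ convex_support_function Sigma phi,
        forall sigma, Sigma sigma -> exists m : 'rV[int]_d,
          forall u, sigma u -> phi u = pairing (toR R m) u
      & forall sigma m, Sigma sigma -> cone_dim sigma = d ->
          (forall u, sigma u -> phi u = pairing m u) ->
          forall u, fan_support Sigma u -> phi u = pairing m u -> sigma u].

(* The (inner) normal fan of a polyhedron P: one cone for each nonempty face
   Q = P `&` {m | <m, u0> = b} of P. *)
Definition normal_fan (P : set 'rV[R]_d) : set (set 'rV[R]_d) :=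
  [set sigma | exists Q : set 'rV[R]_d,
     [/\ Q !=set0,
         exists u0 b, (forall m, P m -> b <= pairing m u0) /\
                      Q = P `&` [set m | pairing m u0 = b]
       & sigma = [set u | forall m m', Q m -> P m' -> pairing m u <= pairing m' u]]].

End Fans.

Section ClassGroup.
Variables (n d : nat) (nu : 'M[int]_(n, d)).

Definition delta (m : 'rV[int]_d) : 'rV[int]_n := m *m nu^T.

Definition principal (a : 'rV[int]_n) : bool := `[< exists m, a = delta m >].

Lemma principal_zmod_closed : zmod_closed principal.
Proof.
split; first by apply/asboolP; exists 0; rewrite /delta mul0mx.
move=> a b /asboolP[m ->] /asboolP[m' ->]; apply/asboolP.
by exists (m - m'); rewrite /delta mulmxBl.
Qed.

HB.instance Definition _ :=
  GRing.isZmodClosed.Build 'rV[int]_n principal principal_zmod_closed.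

(* Cl(X) = Z^n / delta(M), the character group of G. *)
Definition Cl : zmodType :=
  Quotient.quot (GRing.ZmodClosed.clone 'rV[int]_n principal _).

Definition gamma (a : 'rV[int]_n) : Cl := \pi a.

Lemma gamma_eq a b : gamma a = gamma b <-> exists m, a - b = delta m.
Proof.
split=> [/eqP|[m abm]].
  by rewrite /gamma -Quotient.idealrBE => /asboolP.
by apply/eqP; rewrite /gamma -Quotient.idealrBE; apply/asboolP; exists m.
Qed.

Lemma gamma_is_zmod_morphism : zmod_morphism gamma.
Proof. by move=> a b; rewrite /gamma !piE. Qed.

Lemma gamma_surj (c : Cl) : exists a, gamma a = c.
Proof. by exists (repr c); rewrite /gamma reprK. Qed.

Section Real.
Variable R : realType.

Definition deltaR : 'M[R]_(d, n) := (map_mx intr nu)^T.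

(* A basis of the cokernel of the linear map v |-> v *m deltaR from M_R to R^n
   identifies Cl(X)_R with R^r, r being the rank of Cl(X). *)
Definition rankCl : nat := \rank (cokermx deltaR).

Definition gammaR (b : 'rV[R]_n) : 'rV[R]_rankCl := b *m col_base (cokermx deltaR).

Lemma gammaR_eq0 b : gammaR b = 0 <-> exists v : 'rV[R]_d, b = v *m deltaR.
Proof.
have bE : b *m cokermx deltaR = gammaR b *m row_base (cokermx deltaR).
  by rewrite -mulmxA mulmx_base.
split=> [b0|[v bv]].
  have /submxP[v ->] : (b <= deltaR)%MS by rewrite submxE bE b0 mul0mx.
  by exists v.
apply: (row_free_inj (row_base_free (cokermx deltaR))).
by rewrite -bE mul0mx bv -mulmxA mulmx_coker mulmx0.
Qed.

Lemma gammaR_surj (x : 'rV[R]_rankCl) : exists b, gammaR b = x.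
Proof.
have /row_fullP[B BK] : row_full (col_base (cokermx deltaR)).
  exact: col_base_full.
by exists (x *m B); rewrite /gammaR -mulmxA BK mulmx1.
Qed.

Definition tensor1 (c : Cl) : 'rV[R]_rankCl := gammaR (toR R (repr c)).

Lemma tensor1_gamma a : tensor1 (gamma a) = gammaR (toR R a).
Proof.
have /gamma_eq[m e] : gamma (repr (gamma a)) = gamma a by rewrite /gamma reprK.
apply/eqP; rewrite -subr_eq0; apply/eqP.
rewrite /tensor1 /gammaR -mulmxBl; apply/gammaR_eq0; exists (toR R m).
rewrite /toR -map_mxB e /delta /deltaR map_mxM map_trmx //.
Qed.

Definition beta (i : 'I_n) : 'rV[R]_rankCl := tensor1 (gamma (delta_mx 0 i)).

Definition Cbeta : set 'rV[R]_rankCl := cone (range beta).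

Definition generic (chi : Cl) :=
  Cbeta (tensor1 chi) /\
  forall A : set 'rV[R]_rankCl, A `<=` range beta ->
    (cone_dim (cone A) < cone_dim Cbeta)%N -> ~ cone A (tensor1 chi).

Definition P_chi (chi : Cl) : set 'rV[R]_n :=
  [set b : 'rV[R]_n | (forall i, 0 <= b 0 i) /\ gammaR b = tensor1 chi].

Definition F_chi (i : 'I_n) (chi : Cl) : set 'rV[R]_n :=
  P_chi chi `&` [set b : 'rV[R]_n | b 0 i = 0].

Definition P_ (a : 'rV[int]_n) : set 'rV[R]_d :=
  [set m | forall i, - (a 0 i)%:~R <= pairing m (toR R (row i nu))].

Definition I_empty (a : 'rV[int]_n) : set 'I_n :=
  [set i | P_ a `&` [set m | pairing m (toR R (row i nu)) = - (a 0 i)%:~R] = set0].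

Definition GKZ_tilde (Sigma' : set (set 'rV[R]_d)) (I : set 'I_n) : set 'rV[R]_n :=
  [set b : 'rV[R]_n | exists phi, [/\ convex_support_function Sigma' phi,
     forall i, ~ I i -> phi (toR R (row i nu)) = - b 0 i
   & forall i, I i -> - b 0 i <= phi (toR R (row i nu))]].

(* GKZ_tilde contains the kernel of gammaR (subtract a linear form from phi), so
   that its image is its quotient by that kernel. *)
Definition GKZ Sigma' I : set 'rV[R]_rankCl := gammaR @` GKZ_tilde Sigma' I.

Definition secondary_fan : set (set 'rV[R]_rankCl) :=
  [set Gamma | exists a, Cbeta (tensor1 (gamma a)) /\
     Gamma = GKZ (normal_fan (P_ a)) (I_empty a)].

(* The support Cbeta of the secondary fan has full dimension rankCl, so that the
   maximal cones are those of dimension rankCl. *)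
Definition chamber (sigma : set 'rV[R]_rankCl) :=
  secondary_fan sigma /\ cone_dim sigma = rankCl.

End Real.

Arguments tensor1 R c : clear implicits.
Arguments Cbeta R : clear implicits.
Arguments generic R chi : clear implicits.
Arguments P_chi R chi : clear implicits.
Arguments F_chi R i chi : clear implicits.

(* The Cox ring of X_Sigma is k[x_1, ..., x_n], one variable for each row of nu,
   a monomial of exponent m being of degree gamma m. *)
Section Cox.
Variable k : closedFieldType.
Local Notation S := (mpoly n k).

Definition x_ (i : 'I_n) : S := mpolyX k (mnm1 i).

Definition mondeg (m : multinom n) : Cl := gamma (\row_i (m i)%:Z).

Definition homog (c : Cl) (f : S) := forall m, m \in msupp f -> mondeg m = c.

Definition ideal_gen (A : set S) : set S :=
  [set p | exists m (g h : 'I_m -> S), (forall i, A (h i)) /\ p = \sum_i g i * h i].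

(* S_f, for f != 0, inside the fraction field of S. *)
Definition loc (f : S) : set {fraction S} :=
  [set z | exists (g : S) e, z = tofrac g / tofrac f ^+ e].

Definition loc_homog (f : S) (c : Cl) (z : {fraction S}) :=
  exists (g : S) e df dg, [/\ homog df f, homog dg g,
    z = tofrac g / tofrac f ^+ e & c = dg - df *+ e].

Definition unit_degrees (f : S) : set Cl :=
  [set c | exists z w, [/\ loc_homog f c z, loc f w & z * w = 1]].

Definition finite_index (H : set Cl) :=
  exists s : seq Cl, forall c, exists2 c', c' \in s & H (c - c').

(* f = 0 is excluded: S_f is then the zero ring, whose elements have no degree. *)
Definition relevant (f : S) :=
  [/\ f != 0, exists c, homog c f & finite_index (unit_degrees f)].

Definition Gen (R : realType) : set S :=
  [set f | relevant f /\
     exists I : {set 'I_n}, #|I| = rankCl R /\ f = \prod_(i in I) x_ i].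

(* For f != 0 each homogeneous divisor has a unique degree c. *)
Definition weight_cone (R : realType) (f : S) : set 'rV[R]_(rankCl R) :=
  closure (cone [set v | exists (g h : S) e c,
    [/\ f ^+ e = g * h, homog c g & v = tensor1 R c]]).

Definition B_ (R : realType) (chi : Cl) : set S :=
  ideal_gen [set p | exists I : {set 'I_n},
    (P_chi R chi `&` \bigcap_(i in [set` I]) F_chi R i chi) !=set0 /\
    p = \prod_(i in ~: I) x_ i].

End Cox.
End ClassGroup.

Arguments gamma {n d} nu a.
Arguments tensor1 {n d nu} R c.
Arguments Cbeta {n d} nu R.
Arguments generic {n d nu} R chi.
Arguments P_chi {n d nu} R chi.
Arguments F_chi {n d nu} R i chi.
Arguments chamber {n d} nu {R} sigma.
Arguments ideal_gen {n k} A.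
Arguments Gen {n d} nu k R.
Arguments weight_cone {n d} nu {k} R f.
Arguments B_ {n d nu} k R chi.

(* Main.v *)
(* Write G for the matrix of degrees beta_i (gammaR b = b *m G), w for the class
   of a, and call J independent if the beta_j, j in J, are.

   By Caratheodory's theorem w lies in Cone(beta_J) iff it lies in Cone(beta_I)
   for an independent I included in J, and w is generic iff all such I are
   bases.  Both ideals are generated by square-free monomials x^J: those with w
   in Cone(beta_J) for B(chi), and those where moreover J is a basis for the
   other one, since x^I with #|I| = r is relevant iff I is a basis, and its
   weight cone is then Cone(beta_I).  Comparing minimal generators gives the
   equivalence.

   The vertices of P_a are the points of the fibre {b >= 0 | b *m G = w} with
   independent support.  The GKZ cone of a' is contained in Cone(beta_J) for the
   support J of every vertex of P_a', so that a' is generic if its GKZ cone is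
   full-dimensional, and the GKZ cone is then the intersection of all these
   Cone(beta_J).  If it contains a generic w, both fibres have the same vertex
   supports: this is linear programming over the fibre of a' (bases_sub). *)
Require Import Defs.
From HB Require Import structures.
From mathcomp Require Import all_boot all_order all_algebra.
From mathcomp Require Import boolp classical_sets cardinality reals topology.
From mathcomp Require Import normedtype convex.
From mathcomp Require Import -(notations) mpoly.
From mathcomp Require Import lra zify.
Import Order.TTheory GRing.Theory Num.Theory.
Import numFieldNormedType.Exports.
Local Open Scope classical_set_scope.
Local Open Scope ring_scope.

Set Implicit Arguments.
Unset Strict Implicit.
Unset Printing Implicit Defensive.

(** * Vertices of fibres and bases *)

Lemma uniform_small (R : realType) (T : finType) (P : T -> R -> Prop) :
  (forall x, exists e, 0 < e /\ forall t, 0 <= t <= e -> P x t) ->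
  exists e, 0 < e /\ forall x t, 0 <= t <= e -> P x t.
Proof.
(* The initial value 1 of the minimum covers an empty [T]. *)
move=> /choice[f fP]; exists (\big[Num.min/1]_x f x); split.
  by apply/bigmin_gtP; split=> // x _; case: (fP x).
move=> x t /andP[t0 tf]; apply: (fP x).2.
by rewrite t0 (le_trans tf) // bigmin_le_cond.
Qed.

Section Configuration.
Variables (R : realType) (n r : nat) (G : 'M[R]_(n, r)).
Implicit Types (b v : 'rV[R]_n) (I J : {set 'I_n}) (w y : 'rV[R]_r).

Definition supp b : {set 'I_n} := [set i | b 0 i != 0]%SET.

Definition nonneg b := forall i, 0 <= b 0 i.

(** Linear independence of the rows of [G] in [I], tested on vectors over all of ['I_n] so that
    comparing different [I] needs no reindexing. *)
Definition indep I := forall v, supp v \subset I -> v *m G = 0 -> v = 0.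

Definition pos_span I : set 'rV[R]_r :=
  [set y | exists b, [/\ nonneg b, supp b \subset I & y = b *m G]].

Lemma suppP v I :
  reflect (forall i, i \notin I -> v 0 i = 0) (supp v \subset I).
Proof.
apply: (iffP fintype.subsetP) => vI i.
  by move=> iI; apply/eqP; apply: contraNT iI => vi; apply: vI; rewrite inE.
by rewrite inE; apply: contraNT => /vI/eqP.
Qed.

Lemma supp_lin (s : R) b v I :
  supp b \subset I -> supp v \subset I -> supp (b + s *: v) \subset I.
Proof.
move=> /suppP bI /suppP vI; apply/suppP => i iI.
by rewrite !mxE bI // vI // mulr0 addr0.
Qed.

Lemma supp_gt0 b i : nonneg b -> i \in supp b -> 0 < b 0 i.
Proof. by move=> b0; rewrite inE => bi; rewrite lt_neqAle eq_sym bi b0. Qed.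

(** A feasible direction: coordinates in the support are positive and tolerate a small change, the
    others do not decrease. *)
Lemma nonneg_step b v : nonneg b -> (forall i, i \notin supp b -> 0 <= v 0 i) ->
  exists e, 0 < e /\ forall t, 0 <= t <= e -> nonneg (b + t *: v).
Proof.
move=> b0 vb; pose P (i : 'I_n) (t : R) := 0 <= (b + t *: v) 0 i.
suff /uniform_small[e [e0 eP]] :
    forall i, exists e, 0 < e /\ forall t, 0 <= t <= e -> P i t.
  by exists e; split=> // t te i; exact: eP.
move=> i; have [ib|/vb vi] := boolP (i \in supp b); last first.
  by exists 1; split=> // t /andP[t0 _]; rewrite /P !mxE addr_ge0 ?mulr_ge0.
have bi := supp_gt0 b0 ib.
(* The 1 keeps the denominator of the step length positive when [v 0 i] vanishes. *)
have v1 : 0 < 1 + `|v 0 i| by rewrite ltr_pwDl.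
exists (b 0 i / (1 + `|v 0 i|)); split; first exact: divr_gt0.
move=> t /andP[t0]; rewrite ler_pdivlMr // /P !mxE => tb.
have : - (t * v 0 i) <= t * (1 + `|v 0 i|).
  rewrite -mulrN ler_wpM2l // (le_trans (ler_norm _)) // normrN lerDr //.
lra.
Qed.

Definition cost (c : 'I_n -> R) b := \sum_i c i * b 0 i.

Lemma cost_lin c b (s : R) v : cost c (b + s *: v) = cost c b + s * cost c v.
Proof.
rewrite /cost mulr_sumr -big_split; apply: eq_bigr => i _ /=.
by rewrite !mxE mulrDr mulrCA.
Qed.

(** Induction on the size of the support: a dependency among its degrees is a direction inside the
    fibre, oriented so that the cost does not increase and followed until a coordinate vanishes. *)
Lemma caratheodory c b : (forall i, 0 <= c i) -> nonneg b ->
  exists b', [/\ nonneg b', supp b' \subset supp b, b' *m G = b *m G,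
                 indep (supp b') & cost c b' <= cost c b].
Proof.
move=> c0; have [m] := ubnP #|supp b|; elim: m b => // m IH b bm b0.
have [|/existsNP[u /not_implyP[ub /not_implyP[uG /eqP un0]]]] :=
  pselect (indep (supp b)); first by exists b; split.
(* One of [u] and [- u] qualifies: as [c] is nonnegative, a direction without negative coordinates
   has nonnegative cost, and one of positive cost has a positive coordinate. *)
have {u ub uG un0} [v [vb vG [j vj] vc]] : exists v,
    [/\ supp v \subset supp b, v *m G = 0, exists j, v 0 j < 0 & cost c v <= 0].
  have costN : cost c (- u) = - cost c u.
    by rewrite /cost -sumrN; apply: eq_bigr => i _; rewrite !mxE mulrN.
  have [[i ui] | u_ge0] := pselect (exists i, u 0 i < 0); last first.
    have {}u_ge0 i : 0 <= u 0 i.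
      by rewrite leNgt; apply/negP => ui; apply: u_ge0; exists i.
    have [j uj] : exists j, u 0 j != 0.
      apply: contrapT => /forallNP un; case/eqP: un0.
      by apply/rowP => j; have /negP/negPn/eqP -> := un j; rewrite mxE.
    exists (- u); split; rewrite ?mulNmx ?uG ?oppr0 //.
    - by apply/suppP => i /(suppP _ _ ub); rewrite mxE => ->; rewrite oppr0.
    - by exists j; rewrite mxE oppr_lt0 lt_neqAle eq_sym uj u_ge0.
    - by rewrite costN oppr_le0 sumr_ge0 // => i _; rewrite mulr_ge0.
  have [cu|cu] := leP (cost c u) 0; first by exists u; split=> //; exists i.
  exists (- u); split; rewrite ?mulNmx ?uG ?oppr0 //.
  - by apply/suppP => l /(suppP _ _ ub); rewrite mxE => ->; rewrite oppr0.
  - have [[l ul]|/forallNP ul] := pselect (exists l, 0 < u 0 l).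
      by exists l; rewrite mxE oppr_lt0.
    suff : cost c u <= 0 by rewrite leNgt cu.
    apply: sumr_le0 => l _; rewrite mulr_ge0_le0 //.
    by have /negP := ul l; rewrite -leNgt.
  - by rewrite costN oppr_le0 ltW.
(* Ratio test: the least [f i] over the negative coordinates of [v] is the first time at which a
   coordinate decreasing along [v] reaches 0. *)
pose f i := b 0 i / - v 0 i.
have [i vi imin] : exists2 i, v 0 i < 0 & forall l, v 0 l < 0 -> f i <= f l.
  by case: (@arg_minP _ _ _ j (fun i => v 0 i < 0) f vj) => i vi imin; exists i.
have fi0 : 0 <= f i by rewrite divr_ge0 // oppr_ge0 ltW.
pose b1 := b + f i *: v.
have b1_0 : nonneg b1.
  move=> l; rewrite !mxE; have [vl|vl] := leP 0 (v 0 l).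
    by apply: addr_ge0; [exact: b0 | exact: mulr_ge0].
  have := imin l vl; rewrite [f l]/f ler_pdivlMr ?oppr_gt0 // mulrN.
  by rewrite -subr_ge0 opprK.
have b1b : supp b1 \subset supp b by exact: supp_lin.
have b1i : b1 0 i = 0.
  by rewrite !mxE /f invrN mulrN mulNr divfK ?subrr // lt_eqF.
have ib : i \in supp b.
  by apply: (fintype.subsetP vb); rewrite inE lt_eqF.
have /IH : (#|supp b1| < m)%N.
  rewrite -ltnS (leq_trans _ bm) // ltnS; apply: proper_card.
  apply/properP; split=> //; exists i => //.
  by rewrite inE b1i eqxx.
case=> // b2 [b2_0 b2b b2G b2i b2c]; exists b2; split=> //.
- exact: fintype.subset_trans b2b b1b.
- by rewrite b2G mulmxDl -scalemxAl vG scaler0 addr0.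
- by rewrite (le_trans b2c) // cost_lin gerDl mulr_ge0_le0.
Qed.

Lemma pos_span_indep I y : pos_span I y ->
  exists J : {set 'I_n}, [/\ J \subset I, indep J & pos_span J y].
Proof.
case=> b [b0 bI ->].
have [b' [b'0 b'b b'G b'i _]] := @caratheodory (fun=> 0) b (fun=> lexx _) b0.
exists (supp b'); split=> //; first exact: fintype.subset_trans b'b bI.
by exists b'; split.
Qed.

Lemma indep_inj I b v : indep I -> supp b \subset I -> supp v \subset I ->
  b *m G = v *m G -> b = v.
Proof.
move=> iI bI vI bv; apply/eqP; rewrite -subr_eq0; apply/eqP/iI.
  by rewrite -scaleN1r; exact: supp_lin.
by rewrite mulmxBl bv subrr.
Qed.

(** The minimum is attained: [caratheodory] reduces to points with independent support, and such a
    point of the fibre is determined by its support, which leaves finitely many candidates. *)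
Lemma vertex_min c b : (forall i, 0 <= c i) -> nonneg b ->
  exists b', [/\ nonneg b', b' *m G = b *m G, indep (supp b')
    & forall b1, nonneg b1 -> b1 *m G = b *m G -> cost c b' <= cost c b1].
Proof.
move=> c0 b0; pose P (J : {set 'I_n}) (b1 : 'rV[R]_n) :=
  [/\ nonneg b1, b1 *m G = b *m G, supp b1 = J & indep J].
have [b2 [b2_0 _ b2G b2i _]] := caratheodory c0 b0.
have /choice[f fP] : forall J, exists b1, (exists b2, P J b2) -> P J b1.
  move=> J; have [[b1 Pb]|nP] := pselect (exists b1, P J b1).
    by exists b1.
  by exists 0.
have P2 : `[< exists b1, P (supp b2) b1 >] by apply/asboolP; exists b2; split.
have [J /asboolP JP Jmin] := @arg_minP _ _ _ (supp b2)
  (fun J => `[< exists b1, P J b1 >]) (cost c \o f) P2.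
have [f0 fG fJ iJ] := fP J JP.
exists (f J); split; rewrite ?fJ // => b1 b1_0 b1G.
have [b3 [b3_0 _ b3G b3i b3c]] := caratheodory c0 b1_0.
apply: le_trans b3c.
have P3 : exists b4, P (supp b3) b4 by exists b3; split=> //; rewrite b3G.
have /= := Jmin _ (asboolT P3).
have [f30 f3G f3J _] := fP _ P3.
suff -> : f (supp b3) = b3 by [].
by apply: (indep_inj b3i); rewrite ?f3J // f3G b3G.
Qed.

Definition subconf I : 'M[R]_(#|I|, r) := rowsub enum_val G.

Lemma subconfP I v : supp v \subset I ->
  v *m G = (\row_(j < #|I|) v 0 (enum_val j)) *m subconf I.
Proof.
move=> /suppP vI; apply/rowP => l; rewrite !mxE (bigID (mem I)) /=.
rewrite [X in _ + X]big1 ?addr0 => [|i iI]; last by rewrite vI ?mul0r.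
by rewrite big_enum_val; apply: eq_bigr => j _; rewrite !mxE.
Qed.

Lemma subconf_lift I (u : 'rV[R]_(#|I|)) : exists2 v,
  supp v \subset I & u = \row_(j < #|I|) v 0 (enum_val j).
Proof.
exists (\sum_j u 0 j *: delta_mx 0 (enum_val j)).
  apply/suppP => i iI; rewrite summxE big1 // => j _.
  rewrite !mxE eqxx /=; case: eqP iI => [->|]; rewrite ?mulr0 //.
  by rewrite enum_valP.
apply/rowP => j; rewrite mxE summxE (bigD1 j) //= !mxE !eqxx mulr1.
rewrite big1 ?addr0 // => l lj; rewrite !mxE eqxx /= (inj_eq enum_val_inj).
by rewrite eq_sym (negPf lj) mulr0.
Qed.

Lemma indepP I : indep I <-> row_free (subconf I).
Proof.
split=> [iI|fI v vI].
  apply: inj_row_free => u; have [v vI ->] := subconf_lift u.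
  rewrite -(subconfP vI) => /(iI v vI) ->.
  by apply/rowP => j; rewrite !mxE.
rewrite (subconfP vI) -[X in _ = X](mul0mx _ (subconf I)).
move=> /(row_free_inj fI)/rowP v0; apply/rowP => i; rewrite mxE.
have [iI|/(suppP _ _ vI)//] := boolP (i \in I).
by have := v0 (enum_rank_in iI i); rewrite !mxE enum_rankK_in.
Qed.

Lemma indep_card I : indep I -> (#|I| <= r)%N.
Proof. by move=> /indepP/eqP <-; exact: rank_leq_col. Qed.

Lemma spanP I : row_full (subconf I) <->
  forall y, exists2 v, supp v \subset I & y = v *m G.
Proof.
split=> [/row_fullP[B BI] y|sI].
  have [v vI yv] := subconf_lift (y *m B).
  by exists v; rewrite // (subconfP vI) -yv -mulmxA BI mulmx1.
rewrite -sub1mx; apply/row_subP => l; have [v vI ->] := sI (row l 1%:M).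
by rewrite (subconfP vI) submxMl.
Qed.

Lemma basis_span I : indep I -> #|I| = r ->
  forall y, exists2 v, supp v \subset I & y = v *m G.
Proof.
by move=> /indepP/eqP iI cI; apply/spanP; rewrite /row_full iI cI.
Qed.

(** Vacuous outside the cone of all degrees; [generic_vecP] adds membership in [Cbeta]. *)
Definition generic_vec w := forall I, indep I -> pos_span I w -> #|I| = r.

Definition bases w : set {set 'I_n} :=
  [set I | [/\ indep I, #|I| = r & pos_span I w]].

Lemma indepS I J : I \subset J -> indep J -> indep I.
Proof. by move=> IJ iJ v vI; apply: iJ; exact: fintype.subset_trans vI IJ. Qed.

(** A smaller support would be an independent set with fewer than [r] elements whose cone contains
    [w]. *)
Lemma generic_supp w I b : generic_vec w -> indep I -> nonneg b ->
  supp b \subset I -> b *m G = w -> supp b = I.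
Proof.
move=> gw iI b0 bI bw; apply/eqP; rewrite eqEcard bI /=.
rewrite (gw (supp b)) ?indep_card //; first exact: indepS iI.
by exists b; split.
Qed.

Lemma generic_basis w b : generic_vec w -> nonneg b -> b *m G = w ->
  exists2 I, bases w I & I \subset supp b.
Proof.
move=> gw b0 bw.
have [|I [Ib iI Iw]] := @pos_span_indep (supp b) w; first by exists b; split.
by exists I => //; split=> //; exact: gw.
Qed.

(* A vertex of the fibre over [w'] minimising the coordinates outside a basis
   [I] of [w] is supported on [I]: otherwise moving it along the difference of
   the two points of the fibre over [w] supported on [I] and on the support of
   the vertex would decrease the cost. *)
Lemma bases_sub w w' b : generic_vec w -> generic_vec w' ->
    nonneg b -> b *m G = w' -> (forall I, bases w' I -> pos_span I w) ->
  bases w `<=` bases w'.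
Proof.
move=> gw gw' b0 bw' w'w I [iI cI [bI [bI0 bII bIw]]].
pose c i : R := (i \notin I)%:R.
have c0 i : 0 <= c i by rewrite ler0n.
have [b1 [b1_0 b1G b1i b1min]] := vertex_min c0 b0; set J := supp b1.
have Jw' : pos_span J w' by exists b1; split; rewrite ?b1G.
have cJ : #|J| = r by exact: gw'.
have [|bJ [bJ0 bJJ bJw]] := w'w J; first by split.
pose v := bI + (-1) *: bJ.
have vG : v *m G = 0 by rewrite mulmxDl -scalemxAl scaleN1r -bIw -bJw subrr.
have [i /(suppP _ _ bJJ) bJi|e [e0 /(_ e)]] := @nonneg_step b1 v b1_0.
  by rewrite !mxE bJi mulr0 addr0.
rewrite lexx ltW // => /(_ isT) /b1min.
rewrite mulmxDl -scalemxAl vG scaler0 addr0 => /(_ b1G).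
rewrite cost_lin lerDl pmulr_rge0 // cost_lin.
have -> : cost c bI = 0.
  rewrite /cost big1 // => i _; rewrite /c.
  by have [iI'|/(suppP _ _ bII) ->] := boolP (i \in I); rewrite ?mul0r ?mulr0.
rewrite add0r mulN1r oppr_ge0 => cbJ.
have cbJ_ge0 i : true -> 0 <= c i * bJ 0 i by rewrite mulr_ge0.
have /eqP : cost c bJ = 0 by apply: le_anti; rewrite cbJ sumr_ge0.
rewrite psumr_eq0 // => /allP cbJ0.
have JI : J \subset I.
  rewrite /J -(generic_supp gw b1i bJ0 bJJ (esym bJw)); apply/suppP => i iI'.
  have /eqP := cbJ0 i (mem_index_enum _).
  by rewrite /c iI' mul1r.
suff -> : I = J by split.
by apply/eqP; rewrite eq_sym eqEcard JI cI cJ leqnn.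
Qed.

(** By genericity all coordinates of [w] in the basis [I] are positive, so [w] is interior to the
    cone of [I]. *)
Lemma bases_step w I y : generic_vec w -> bases w I ->
  exists e, 0 < e /\ forall t, 0 <= t <= e -> pos_span I (w + t *: y).
Proof.
move=> gw [iI cI [b [b0 bI bw]]]; have [v vI ->] := basis_span iI cI y.
have [i|e [e0 eP]] := @nonneg_step b v b0.
  rewrite (generic_supp gw iI b0 bI (esym bw)) => /(suppP _ _ vI) ->.
  by [].
exists e; split=> // t /eP tb; exists (b + t *: v); split=> //.
  exact: supp_lin.
by rewrite mulmxDl -scalemxAl bw.
Qed.

(** Shows that the intersection of the cones is full-dimensional: it contains the vectors
    [w + t e_j] for one small [t] that serves the finitely many pairs of [j] and [I]. *)
Lemma bases_interior w : generic_vec w ->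
  exists X : 'M[R]_r, row_free X /\
    forall j I, bases w I -> pos_span I (row j X).
Proof.
move=> gw; pose P (jI : 'I_r * {set 'I_n}) (t : R) :=
  bases w jI.2 -> pos_span jI.2 (w + t *: row jI.1 1%:M).
have [[j I]|e [e0 eP]] := @uniform_small R _ P.
  have [wI|nwI] := pselect (bases w I); last first.
    by exists 1; split=> // t _ wI.
  have [e [e0 eP]] := bases_step (row j 1%:M) gw wI.
  by exists e; split=> // t te _; exact: eP.
(* For positive [t] the matrix with rows [w + t e_j] is singular only if [t = - s]; one of [e] and
   [e / 2] avoids this value. *)
pose s := \sum_j w 0 j.
have [t [t0 te ts]] : exists t, [/\ 0 < t, t <= e & t + s != 0].
  have [es|es] := eqVneq (e + s) 0; last by exists e; split.
  exists (e / 2); split; rewrite ?divr_gt0 //; first by lra.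
  by apply/eqP => es'; lra.
exists (t%:M + const_mx 1 *m w); split; last first.
  move=> j I wI; have := eP (j, I) t; rewrite (ltW t0) te => /(_ isT wI) /=.
  congr (pos_span I _); apply/rowP => l; rewrite !mxE addrC big_ord1 mxE mul1r.
  by rewrite mulr_natr.
apply: inj_row_free => u; rewrite mulmxDr mul_mx_scalar mulmxA => uX.
pose q := \sum_j u 0 j.
have uE j : t * u 0 j + q * w 0 j = 0.
  have /rowP/(_ j) := uX; rewrite !mxE big_ord1 !mxE => <-.
  by congr (_ + _ * _); apply: eq_bigr => l _; rewrite mxE mulr1.
have /eqP : q * (t + s) = 0.
  rewrite mulrDr mulrC !mulr_sumr -big_split /=.
  by rewrite big1 // => j _; exact: uE.
rewrite mulf_eq0 (negPf ts) orbF => /eqP q0.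
apply/rowP => j; have /eqP := uE j.
by rewrite q0 mul0r addr0 mulf_eq0 gt_eqF //= => /eqP ->; rewrite mxE.
Qed.

End Configuration.

(** * GKZ cones *)

Section GKZ.
Variables (R : realType) (n d : nat) (nu : 'M[int]_(n, d)).
Implicit Types (m u v : 'rV[R]_d) (b : 'rV[R]_n) (a : 'rV[int]_n).

Local Notation D := (deltaR nu R).
Local Notation G := (col_base (cokermx D)).

Lemma pairingDl m m' u : pairing (m + m') u = pairing m u + pairing m' u.
Proof.
by rewrite /pairing -big_split; apply: eq_bigr => i _; rewrite mxE mulrDl.
Qed.

Lemma pairingZl (s : R) m u : pairing (s *: m) u = s * pairing m u.
Proof.
by rewrite /pairing mulr_sumr; apply: eq_bigr => i _; rewrite mxE mulrA.
Qed.

Lemma pairingC m u : pairing m u = pairing u m.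
Proof. by apply: eq_bigr => i _; rewrite mulrC. Qed.

Lemma pairingDr m u v : pairing m (u + v) = pairing m u + pairing m v.
Proof. by rewrite pairingC pairingDl !(pairingC m). Qed.

Lemma pairingZr (s : R) m u : pairing m (s *: u) = s * pairing m u.
Proof. by rewrite pairingC pairingZl pairingC. Qed.

Lemma pairing_sumr (I : finType) (P : pred I) m (u : I -> 'rV[R]_d) :
  pairing m (\sum_(i | P i) u i) = \sum_(i | P i) pairing m (u i).
Proof.
rewrite (big_morph _ (pairingDr m) (_ : _ = 0)) //.
by rewrite /pairing big1 // => i _; rewrite mxE mulr0.
Qed.

Local Notation ray i := (toR R (row i nu)).

Lemma pairing_ray m i : pairing m (ray i) = (m *m D) 0 i.
Proof. by rewrite mxE; apply: eq_bigr => j _; rewrite !mxE. Qed.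

(** Coordinate [i] of [toR R a + m *m D] is the slack of the [i]-th inequality at [m]. Together with
    [gammaR_fibre] this identifies [P_a] with the nonnegative fibre over the class of [a]. *)
Lemma P_nonneg a m : P_ nu a m <-> nonneg (toR R a + m *m D).
Proof.
have PE i : (0 <= (toR R a + m *m D) 0 i) =
    (- (a 0 i)%:~R <= pairing m (ray i)).
  by rewrite mxE [toR R a 0 i]mxE -pairing_ray addrC -lerBlDr sub0r.
by split=> Pm i; have := Pm i; rewrite PE.
Qed.

Lemma gammaR_fibre a b : gammaR nu b = gammaR nu (toR R a) ->
  exists m, b = toR R a + m *m D.
Proof.
move=> ba; have /gammaR_eq0[m bm] : gammaR nu (b - toR R a) = 0.
  by rewrite /gammaR mulmxBl; apply/eqP; rewrite subr_eq0; apply/eqP.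
by exists m; rewrite -bm addrC subrK.
Qed.

Lemma gammaR_add b m : gammaR nu (b + m *m D) = gammaR nu b.
Proof.
rewrite /gammaR mulmxDl.
have : gammaR nu (m *m D) = 0 by apply/gammaR_eq0; exists m.
by rewrite /gammaR => ->; rewrite addr0.
Qed.

Hypothesis D_free : row_free D.

(* Gale duality: the rays outside an independent set of degrees span. *)
Lemma compl_span (J : {set 'I_n}) j : indep G J ->
  exists k : 'I_n -> R,
    forall m, (m *m D) 0 j = \sum_(i in ~: J) k i * (m *m D) 0 i.
Proof.
move=> iJ.
(* If [m] pairs to 0 with all rays outside [J], then [m *m D] is a relation among the degrees in
   [J], hence 0. *)
have [C DC] : exists C, colsub (@enum_val _ (mem (~: J))) D *m C = 1%:M.
  apply/row_freeP/inj_row_free => m mD; apply: (row_free_inj D_free).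
  rewrite mul0mx; apply: iJ; last by apply/gammaR_eq0; exists m.
  apply/suppP => i iJ; have iJ' : i \in ~: J by rewrite inE.
  have /rowP/(_ (enum_rank_in iJ' i)) := mD.
  rewrite [LHS]mxE [RHS]mxE => <-; rewrite mxE.
  by apply: eq_bigr => l _; rewrite [colsub _ _ _ _]mxE enum_rankK_in.
pose c := C *m col j D.
exists (fun i => if [pick l | enum_val l == i] is Some l then c l 0 else 0).
move=> m; have -> : (m *m D) 0 j = (m *m colsub enum_val D *m c) 0 0.
  rewrite /c mulmxA -(mulmxA m) DC mulmx1 [LHS]mxE [RHS]mxE.
  by apply: eq_bigr => l _; rewrite [col _ _ _ _]mxE.
rewrite mxE [RHS]big_enum_val; apply: eq_bigr => l _.
case: pickP => [l' /eqP/enum_val_inj ->|/(_ l)]; last by rewrite eqxx.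
rewrite mulrC; congr (_ * _); rewrite [LHS]mxE [RHS]mxE.
by apply: eq_bigr => l1 _; rewrite [colsub _ _ _ _]mxE.
Qed.

(** Pairing with the ray is slack coordinate [j] up to a constant, so it attains its minimum on
    [P_a] by [vertex_min]; the ray lies in the normal cone of the face of minimisers. *)
Lemma ray_support a b j : nonneg b -> gammaR nu b = gammaR nu (toR R a) ->
  fan_support (normal_fan (P_ nu a)) (ray j).
Proof.
move=> b0 ba; pose c (i : 'I_n) : R := (i == j)%:R.
have c0 i : 0 <= c i by rewrite ler0n.
have [b1 [b1_0 b1G _ b1min]] := vertex_min G c0 b0.
have costE b2 : cost c b2 = b2 0 j.
  rewrite /cost (bigD1 j) //= /c eqxx mul1r big1 ?addr0 // => i /negPf ->.
  by rewrite mul0r.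
have [m1 b1E] : exists m, b1 = toR R a + m *m D.
  by apply: gammaR_fibre; rewrite -ba.
have m1P : P_ nu a m1 by apply/P_nonneg; rewrite -b1E.
have m1min m : P_ nu a m -> pairing m1 (ray j) <= pairing m (ray j).
  move=> mP; have := b1min (toR R a + m *m D).
  rewrite !costE b1E [X in X <= _]mxE [X in _ <= X]mxE lerD2l -!pairing_ray.
  apply.
    exact/P_nonneg.
  by rewrite -[_ *m G]/(gammaR nu _) gammaR_add -ba.
exists [set u | forall m m', (P_ nu a `&`
    [set m | pairing m (ray j) = pairing m1 (ray j)]) m -> P_ nu a m' ->
    pairing m u <= pairing m' u]; last by move=> m m' [_ /= ->]; exact: m1min.
eexists; split; last by [].
  by exists m1; split.
by exists (ray j), (pairing m1 (ray j)); split.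
Qed.

(** On the normal cone at the vertex [m], [phi] is a linear form [ms], and concavity puts [phi]
    below [ms] on all rays. Hence [b + ms *m D] is a nonnegative representative of [y] that vanishes
    at the inequalities tight at [m]. *)
Lemma GKZ_sub a m : P_ nu a m -> indep G (supp (toR R a + m *m D)) ->
  @GKZ n d nu R (normal_fan (P_ nu a)) (I_empty nu R a) `<=`
    pos_span G (supp (toR R a + m *m D)).
Proof.
set b' := toR R a + m *m D => mP iJ y.
move=> [b [phi [[philin phiconc] phieq phile]] <-].
have b'0 : nonneg b' by apply/P_nonneg.
pose T := ~: supp b'.
(* Minimising [u0] over [P_a] makes every inequality in [T] tight, so [Q] is the face where they all
   are. *)
pose u0 : 'rV[R]_d := \sum_(i in T) ray i.
have mT i : i \in T -> pairing m (ray i) = - (a 0 i)%:~R.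
  rewrite !inE negbK => /eqP; rewrite mxE pairing_ray [toR R a 0 i]mxE => /eqP.
  by rewrite addrC addr_eq0 => /eqP.
pose Q := P_ nu a `&` [set m' | pairing m' u0 = pairing m u0].
have QT m' i : Q m' -> i \in T -> pairing m' (ray i) = - (a 0 i)%:~R.
  case=> m'P /eqP; rewrite -subr_eq0 /u0 !pairing_sumr -sumrB.
  rewrite psumr_eq0 => [/allP/(_ i (mem_index_enum _))/implyP h iT|l lT].
    by move/eqP: (h iT); rewrite mT // => /eqP; rewrite subr_eq0 => /eqP.
  by rewrite mT // subr_ge0; exact: m'P.
pose sigma :=
  [set u | forall m m', Q m -> P_ nu a m' -> pairing m u <= pairing m' u].
have sigmaN : normal_fan (P_ nu a) sigma.
  exists Q; split=> //; first by exists m.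
  exists u0, (pairing m u0); split=> // m' m'P.
  by rewrite /u0 !pairing_sumr; apply: ler_sum => i /mT ->; exact: m'P.
have [ms phims] := philin _ sigmaN.
have sigmaT (k : 'I_n -> R) u : (forall i, 0 <= k i) ->
    (forall m, pairing m u = \sum_(i in T) k i * pairing m (ray i)) -> sigma u.
  move=> k0 uE m1 m2 m1Q m2P; rewrite !uE; apply: ler_sum => i iT.
  by rewrite ler_wpM2l // (QT m1) //; exact: m2P.
have ray_sigma i : i \in T -> sigma (ray i).
  move=> iT; apply: (sigmaT (fun l => (l == i)%:R)) => [l|m1].
    exact: ler0n.
  rewrite (bigD1 i) //= eqxx mul1r big1 ?addr0 // => l /andP[_ /negPf ->].
  by rewrite mul0r.
(* The point [m] itself shows that [i] is outside [I_empty], where the GKZ condition is an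
   equality. *)
have phiT i : i \in T -> pairing ms (ray i) = - b 0 i.
  move=> iT; rewrite -phims; last exact: ray_sigma.
  rewrite phieq // => /seteqP[+ _] => /(_ m); apply; split=> //.
  exact: mT.
have phi_ray j : phi (ray j) <= pairing ms (ray j).
  have [k kE] := compl_span j iJ.
  (* Adding [s *: u0] makes all coefficients of the ray on [T] nonnegative, so the midpoint of
     [s *: u0] and the ray lies in [sigma], where [phi] is [ms]; concavity at this midpoint gives
     the bound. *)
  pose s := \sum_i `|k i|.
  have ks i : 0 <= s + k i.
    rewrite /s (bigD1 i) //= addrAC addr_ge0 ?sumr_ge0 //.
    by rewrite -lerBlDr sub0r -normrN ler_norm.
  have s0 : 0 <= s by rewrite sumr_ge0.
  have su0 : sigma (s *: u0).
    apply: (sigmaT (fun=> s)) => // m1.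
    by rewrite pairingZr pairing_sumr mulr_sumr.
  have mid : sigma ((2^-1) *: (s *: u0) + (1 - 2^-1) *: ray j).
    apply: (sigmaT (fun i => 2^-1 * (s + k i))) => [i|m1].
      by rewrite mulr_ge0 // invr_ge0.
    have -> : 1 - 2^-1 = 2^-1 :> R by lra.
    rewrite pairingDr !pairingZr -mulrDr pairing_sumr mulr_sumr pairing_ray kE.
    rewrite -big_split mulr_sumr; apply: eq_bigr => i _ /=.
    by rewrite pairing_ray -mulrDl mulrA.
  have := phiconc (s *: u0) (ray j) 2^-1.
  rewrite (phims _ mid) (phims _ su0) pairingDr !pairingZr lerD2l.
  rewrite ler_pM2l; last by lra.
  apply; [by exists sigma | | by lra].
  by apply: (ray_support _ b'0); rewrite gammaR_add.
exists (b + ms *m D); split; last by rewrite -[RHS]/(gammaR nu _) gammaR_add.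
- move=> i; rewrite mxE -pairing_ray addrC -lerBlDr sub0r.
  apply: le_trans (phi_ray i); have [iI|nI] := pselect (I_empty nu R a i).
    exact: phile.
  by rewrite phieq.
- apply/suppP => i ib'; rewrite mxE -pairing_ray phiT ?subrr //.
  by rewrite inE.
Qed.

(** Each basis [I] gives a linear form [f I] such that [b + f I *m D] represents [y] and is
    supported on [I]. The minimum of these forms is the required support function. *)
Lemma GKZ_sup a b : nonneg b -> gammaR nu b = gammaR nu (toR R a) ->
  generic_vec G (gammaR nu (toR R a)) ->
  [set y | forall I, bases G (gammaR nu (toR R a)) I -> pos_span G I y] `<=`
    @GKZ n d nu R (normal_fan (P_ nu a)) (I_empty nu R a).
Proof.
move: b => b1 b1_0 b1a; set w := gammaR nu (toR R a) => gw y yP.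
have [b yE] := gammaR_surj y.
have fib m : P_ nu a m ->
    exists2 I, bases G w I & I \subset supp (toR R a + m *m D).
  move=> /P_nonneg m0; apply: (generic_basis gw m0).
  by rewrite -[LHS]/(gammaR nu _) gammaR_add.
have [I0 I0w _] := generic_basis gw b1_0 b1a.
have /choice[f fP] : forall I, exists m, bases G w I ->
    nonneg (b + m *m D) /\ supp (b + m *m D) \subset I.
  move=> I; have [Iw|nIw] := pselect (bases G w I); last by exists 0.
  have [bI [bI0 bII bIy]] := yP I Iw.
  have /gammaR_eq0[m bm] : gammaR nu (bI - b) = 0.
    by rewrite /gammaR mulmxBl -bIy -[b *m _]/(gammaR nu b) yE subrr.
  by exists m => _; rewrite -bm addrC subrK.
have f_ge I i : bases G w I -> - b 0 i <= pairing (f I) (ray i).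
  by move=> /fP[/(_ i) + _]; rewrite mxE -pairing_ray addrC -lerBlDr sub0r.
have f_eq I i : bases G w I -> i \notin I -> pairing (f I) (ray i) = - b 0 i.
  move=> /fP[_ /suppP h] /h /eqP; rewrite mxE -pairing_ray addrC addr_eq0.
  by move/eqP.
(* [I0] is itself a basis of [w], so the initial value does not change the minimum. *)
pose phi u : R :=
  \big[Num.min/pairing (f I0) u]_(I | `[< bases G w I >]) pairing (f I) u.
have phi_le I u : bases G w I -> phi u <= pairing (f I) u.
  by move=> Iw; apply: bigmin_le_cond; apply/asboolP.
have le_phi x u : (forall I, bases G w I -> x <= pairing (f I) u) -> x <= phi u.
  by move=> xf; apply/bigmin_geP; split=> [|I /asboolP]; exact: xf.
exists b => //; exists phi; split; first split.
- move=> sigma [Q [[m mQ] [u0 [c [Pc QE]]] ->]].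
  have mP : P_ nu a m by move: mQ; rewrite QE => -[].
  have [I Iw Ib] := fib m mP.
  exists (f I) => u uQ; apply/eqP; rewrite eq_le phi_le //=.
  (* Outside the support of [m], hence outside [I], the form [f I] takes its least allowed value on
     the ray. So [f I' - f I] is a feasible direction at [m], along which [u] cannot decrease. *)
  apply: le_phi => I' I'w; pose v := (f I' - f I).
  have [i|e [e0 /(_ e)]] := nonneg_step (v := v *m D) (proj1 (P_nonneg a m) mP).
    move=> ib; have iI : i \notin I by apply: contra ib; exact: fintype.subsetP.
    rewrite -pairing_ray /v -scaleN1r pairingDl pairingZl mulN1r subr_ge0.
    by rewrite f_eq // f_ge.
  rewrite lexx ltW // => /(_ isT).
  rewrite scalemxAl -addrA -mulmxDl => /P_nonneg/(uQ m _ mQ).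
  rewrite pairingDl lerDl pairingZl pmulr_rge0 // /v -scaleN1r pairingDl.
  by rewrite pairingZl mulN1r subr_ge0.
- move=> u v t _ _ /andP[t0 t1]; apply: le_phi => I Iw.
  by rewrite pairingDr !pairingZr lerD // ler_wpM2l ?phi_le ?subr_ge0.
(* Some point of [P_a] is tight at [i]; a basis inside its support omits [i], and its form attains
   [- b 0 i]. *)
- move=> i nI; apply/eqP; rewrite eq_le le_phi ?andbT; last by move=> I /f_ge.
  have [m [mP mi]] : exists m, P_ nu a m /\ pairing m (ray i) = - (a 0 i)%:~R.
    apply: contrapT => h; apply: nI; apply/seteqP; split=> // m mi.
    by apply: h; exists m.
  have [I Iw Ib] := fib m mP.
  rewrite -(f_eq I) ?phi_le //; apply/negP => /(fintype.subsetP Ib).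
  by rewrite inE mxE -pairing_ray mi mxE subrr eqxx.
- by move=> i _; apply: le_phi => I /f_ge.
Qed.

End GKZ.

(** * Square-free monomials *)

Section Monomials.
Variables (k : closedFieldType) (n d : nat) (nu : 'M[int]_(n, d)).
Implicit Types (I J : {set 'I_n}) (m : multinom n).
Local Notation S := (mpoly n k).

Definition mexp (F : 'I_n -> nat) : multinom n := Multinom (mktuple F).

Lemma mexpE F i : mexp F i = F i. Proof. exact: mnmE. Qed.

Definition mset I : multinom n := mexp (fun i => (i \in I)).

Definition xset I : S := \prod_(i in I) x_ k i.

Lemma xsetE I : xset I = mpolyX k (mset I).
Proof.
rewrite /xset -[LHS]big_enum -(big_map (fun i => mnm1 i) xpredT (mpolyX k)) /=.
rewrite mpolyX_prod; congr mpolyX; apply/mnmP => j.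
rewrite mnm_sumE big_map big_enum mexpE /=.
rewrite (eq_bigr (fun i => (i == j : nat))) => [|i _]; last exact: mnm1E.
have [jI|jI] := boolP (j \in I).
  by rewrite (bigD1 j) //= eqxx big1 // => i /andP[_ /negPf ->].
by rewrite big1 // => i iI; case: eqP jI => // <-; rewrite iI.
Qed.

Lemma mpolyX_neq0 m : mpolyX k m != 0.
Proof.
apply/eqP => X0; have := mcoeffX k m m.
by rewrite X0 mcoeff0 eqxx => /esym/eqP; rewrite oner_eq0.
Qed.

Lemma xset_neq0 I : xset I != 0.
Proof. by rewrite xsetE mpolyX_neq0. Qed.

Lemma xset_sub I J : I \subset J -> xset J = xset (J :\: I) * xset I.
Proof.
by move=> IJ; rewrite /xset (big_setID I) (finset.setIidPr IJ) mulrC.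
Qed.

Lemma ideal_gen_sub (A A' : set S) :
  (forall p, A p -> exists g q, A' q /\ p = g * q) ->
  ideal_gen A `<=` ideal_gen A'.
Proof.
move=> AA' _ [m [g [h [hA ->]]]].
have /choice[u /choice[q uq]] : forall i, exists u q, A' q /\ h i = u * q.
  by move=> i; exact: AA'.
exists m, (fun i => g i * u i), q; split=> [i|]; first exact: (uq i).1.
by apply: eq_bigr => i _; rewrite -mulrA -(uq i).2.
Qed.

(** The monomial must occur in some [g i * h i], so a generator divides it; for square-free
    exponents divisibility is inclusion. *)
Lemma xset_ideal (A : set {set 'I_n}) J :
  ideal_gen (xset @` A) (xset J) -> exists2 I, A I & I \subset J.
Proof.
case=> l [g [h [hA Jgh]]].
have /choice[I hI] : forall i, exists I, A I /\ xset I = h i.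
  by move=> i; have [I AI <-] := hA i; exists I.
have [i iJ|h0] := pickP (fun i => mset J \in msupp (g i * h i)).
  exists (I i); first exact: (hI i).1.
  move: iJ; rewrite -(hI i).2 xsetE => /msuppM_le; rewrite msuppX.
  case/allpairsP => -[m1 m2] /= [_]; rewrite mem_seq1 => /eqP -> Jm.
  apply/fintype.subsetP => j jI; have := congr1 (fun m : multinom n => m j) Jm.
  by rewrite mnmDE !mexpE jI; case: (j \in J) => //; rewrite addn1.
have := mcoeffX k (mset J) (mset J).
rewrite -xsetE Jgh raddf_sum big1 => [/eqP|i _].
  by rewrite eqxx eq_sym oner_eq0.
by apply/eqP; have := h0 i; rewrite mcoeff_msupp => /negbT/negPn.
Qed.

Local Notation gam := (gamma nu).

Lemma gammaB a b : gam (a - b) = gam a - gam b.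
Proof. exact: gamma_is_zmod_morphism. Qed.

Lemma gamma0 : gam 0 = 0.
Proof. by have := gammaB 0 0; rewrite !subrr. Qed.

Lemma gammaN a : gam (- a) = - gam a.
Proof. by have := gammaB 0 a; rewrite gamma0 !sub0r. Qed.

Lemma gammaD a b : gam (a + b) = gam a + gam b.
Proof. by have := gammaB a (- b); rewrite gammaN !opprK. Qed.

Lemma gammaMn a e : gam (a *+ e) = gam a *+ e.
Proof. by elim: e => [|e IH]; rewrite ?mulr0n ?gamma0 // !mulrS gammaD IH. Qed.

Definition mrow m : 'rV[int]_n := \row_i (m i)%:Z.

Lemma homogX m : homog (mondeg nu m) (mpolyX k m).
Proof. by move=> m'; rewrite msuppX mem_seq1 => /eqP ->. Qed.

Lemma homog_deg (c : Cl nu) (f : S) :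
  f != 0 -> homog c f -> c = gam (mrow (mlead f)).
Proof. by move=> f0 /(_ _ (mlead_supp f0)). Qed.

(* Only the leading monomials of the factors are needed, although all factors of
   a power of a monomial are monomials up to a constant. *)
Lemma xset_divisor I e (g h : S) : xset I ^+ e = g * h ->
  [/\ g != 0, h != 0 & forall i, (mlead g i + mlead h i = (i \in I) * e)%N].
Proof.
move=> gh; have : g * h != 0 by rewrite -gh expf_neq0 // xset_neq0.
rewrite mulf_eq0 negb_or => /andP[g0 h0]; split=> // i.
rewrite -mnmDE -mleadM // -gh xsetE mleadX ?mpolyX_neq0 // mleadXm mulmnE.
by rewrite mexpE.
Qed.

(** The homogeneous units are, up to scalars, the Laurent monomials in the variables of [I]. *)
Lemma unit_degrees_xset I (c : Cl nu) : unit_degrees (xset I) c <->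
  exists z : 'rV[int]_n, (forall i, i \notin I -> z 0 i = 0) /\ c = gam z.
Proof.
have f0 : tofrac (xset I) != 0 by rewrite tofrac_eq0 xset_neq0.
split=> [[z [w [+ [h [e' wE]] zw1]]]|[z [zI ->]]].
  move=> [g [e [df [dg [fdf gdg zE ->]]]]].
  have gh : xset I ^+ (e + e') = g * h.
    apply/eqP; rewrite -tofrac_eq tofracXn tofracM exprD; apply/eqP.
    move: zw1; rewrite zE wE mulf_div => /(canRL (divfK _)) ->.
      by rewrite mul1r.
    by rewrite mulf_neq0 ?expf_neq0.
  have [g0 h0 ghI] := xset_divisor gh.
  exists (mrow (mlead g) - mrow (mset I) *+ e); split.
    move=> i iI; rewrite !mxE mulmxnE !mxE mexpE (negPf iI) mul0rn subr0.
    have := ghI i; rewrite (negPf iI) mul0n => /eqP.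
    by rewrite addn_eq0 => /andP[/eqP ->].
  rewrite gammaB gammaMn -(homog_deg g0 gdg); congr (_ - _ *+ _).
  by rewrite (homog_deg (xset_neq0 I) fdf) xsetE mleadXm.
pose za i := absz (z 0 i).
(* [e] bounds every [|z_i|], so [e + z_i] and [e - z_i] are exponents of two numerators with inverse
   quotients. *)
pose e := (\sum_i za i)%N.
have ze i : (za i <= e)%N by rewrite /e (bigD1 i) //= leq_addr.
pose z1 i : int := z 0 i + e%:Z; pose z2 i : int := e%:Z - z 0 i.
pose m1 := mexp (fun i => if i \in I then absz (z1 i) else 0%N).
pose m2 := mexp (fun i => if i \in I then absz (z2 i) else 0%N).
exists (tofrac (mpolyX k m1) / tofrac (xset I) ^+ e).
exists (tofrac (mpolyX k m2) / tofrac (xset I) ^+ e).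
split.
- exists (mpolyX k m1), e, (gam (mrow (mset I))), (gam (mrow m1)); split=> //.
  + by rewrite xsetE; exact: homogX.
  + exact: homogX.
  + rewrite -gammaMn -gammaB; congr gam; apply/rowP => i.
    rewrite !mxE mulmxnE !mxE !mexpE; case: ifPn => [iI|/zI ->].
      by have := ze i; rewrite natz /za /z1; lia.
    by rewrite mul0rn subr0.
- by exists (mpolyX k m2), e.
- rewrite mulf_div -tofracM -!tofracXn -tofracM.
  suff -> : mpolyX k m1 * mpolyX k m2 = xset I ^+ e * xset I ^+ e.
    apply: divff; rewrite tofrac_eq0; apply: mulf_neq0; apply: expf_neq0.
      exact: xset_neq0.
    exact: xset_neq0.
  rewrite xsetE !mpolyXn -!mpolyXD; congr mpolyX; apply/mnmP => i.
  rewrite !mnmDE mulmnE !mexpE; case: ifPn => // iI.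
  by have := ze i; rewrite /za /z1 /z2; lia.
Qed.

End Monomials.

(** * Cones generated by rows; the rays span *)

Section ConesOfRows.
Variables (R : realType) (n r : nat) (G : 'M[R]_(n, r)).
Implicit Types (I : {set 'I_n}) (A : set 'rV[R]_r).

Lemma cone_sub_pos_span I A : A `<=` pos_span G I -> cone A `<=` pos_span G I.
Proof.
move=> AI _ [m [c [v [c0 /= vA ->]]]].
have /choice[b bP] : forall l, exists b,
    [/\ nonneg b, supp b \subset I & v l = b *m G].
  by move=> l; exact: AI.
exists (\sum_l c l *: b l); split.
- move=> i; rewrite summxE sumr_ge0 // => l _.
  by rewrite mxE mulr_ge0 //; have [] := bP l.
- apply/suppP => i iI; rewrite summxE big1 // => l _.
  by have [_ /suppP/(_ i iI) bi _] := bP l; rewrite mxE bi mulr0.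
- rewrite mulmx_suml; apply: eq_bigr => l _.
  by have [_ _ ->] := bP l; rewrite scalemxAl.
Qed.

Lemma pos_span_row I i : i \in I -> pos_span G I (row i G).
Proof.
move=> iI; exists (delta_mx 0 i); split; last exact: rowE.
  by move=> j; rewrite mxE ler0n.
apply/suppP => j jI; rewrite mxE.
  by have [ji|_] := eqVneq j i; [rewrite ji iI in jI | rewrite andbF].
Qed.

Lemma pos_span_sub_cone I A : (forall i, i \in I -> A (row i G)) ->
  pos_span G I `<=` cone A.
Proof.
move=> IA _ [b [b0 /suppP bI ->]].
exists #|I|, (fun l => b 0 (enum_val l)), (fun l => row (enum_val l) G).
split=> [l|l|]; [exact: b0 | exact/IA/enum_valP |].
rewrite -(big_enum_val (fun i => b 0 i *: row i G)) mulmx_sum_row.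
rewrite [RHS]big_mkcond; apply: eq_bigr => i _.
by case: ifPn => // /bI ->; rewrite scale0r.
Qed.

Lemma cone_range_row : cone (range (fun i => row i G)) = pos_span G [set: 'I_n].
Proof.
apply/seteqP; split.
  by apply: cone_sub_pos_span => _ [i _ <-]; exact: pos_span_row.
by apply: pos_span_sub_cone => i _; exists i.
Qed.

Lemma pos_span_submx I x : pos_span G I x -> (x <= subconf G I)%MS.
Proof. by case=> b [_ bI ->]; rewrite (subconfP G bI) submxMl. Qed.

Lemma cone_dim_ge A m (B : 'M[R]_(m, r)) :
  row_free B -> (forall i, A (row i B)) -> (m <= cone_dim A)%N.
Proof.
move=> fB BA; have mr : (m < r.+1)%N by rewrite ltnS -(eqP fB) rank_leq_col.
apply: (leq_bigmax_cond (Ordinal mr)); apply/asboolP.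
by exists B.
Qed.

Lemma cone_dim_le A m (B : 'M[R]_(m, r)) :
  (forall x, A x -> (x <= B)%MS) -> (cone_dim A <= \rank B)%N.
Proof.
move=> AB; apply/bigmax_leqP => l /asboolP[C [fC CA]].
rewrite -(eqP fC); apply: mxrankS; apply/row_subP => i; exact: AB.
Qed.

(** In coordinates with respect to the basis [I] the cone is an orthant, a finite intersection of
    closed half-spaces. *)
Lemma closed_pos_span I : indep G I -> #|I| = r -> closed (pos_span G I).
Proof.
move=> iI cI; have fI : row_free (subconf G I) by apply/indepP.
have uI : row_full (subconf G I) by rewrite /row_full (eqP fI) cI.
pose C := pinvmx (subconf G I).
have -> : pos_span G I = \bigcap_j [set y | 0 <= (y *m C) 0 j].
  apply/seteqP; split=> [_ [b [b0 bI ->]] j _ /=|y yC].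
    by rewrite (subconfP G bI) -mulmxA mulmxVp // mulmx1 mxE.
  have [v vI yv] := subconf_lift (y *m C).
  exists v; split=> //; last first.
    by rewrite (subconfP G vI) -yv -mulmxA mulVpmx ?mulmx1.
  move=> i; have [iI'|/(suppP _ _ vI) -> //] := boolP (i \in I).
  have := yC (enum_rank_in iI' i) Logic.I.
  by rewrite /= yv mxE enum_rankK_in.
apply: closed_bigI => j _.
have -> : [set y | 0 <= (y *m C) 0 j] =
    (fun y : 'rV[R]_r => \sum_l y 0 l * C l j) @^-1` [set x : R | 0 <= x].
  by apply/seteqP; split=> y /=; rewrite mxE.
apply: preimage_closed; last exact: closed_ge.
move=> y _; elim: (index_enum _) y => [|l s IH] y.
  have -> : (fun y : 'rV[R]_r => \sum_(l <- [::]) y 0 l * C l j) = (fun=> 0).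
    by apply/funext => z; rewrite big_nil.
  exact: cst_continuous.
have -> : (fun y : 'rV[R]_r => \sum_(i <- l :: s) y 0 i * C i j) =
    (fun y => y 0 l * C l j) \+ (fun y => \sum_(i <- s) y 0 i * C i j).
  by apply/funext => z; rewrite big_cons.
apply: continuousD (IH y); apply: continuousM; last exact: cst_continuous.
exact: coord_continuous.
Qed.

End ConesOfRows.

Section Rays.
Variables (R : realType) (n d : nat) (nu : 'M[int]_(n, d)).
Variable Sigma : set (set 'rV[R]_d).
Hypotheses (fan_Sigma : is_fan Sigma) (rays_Sigma : ray_generators Sigma nu).
Hypotheses (simplicial_Sigma : simplicial Sigma).

Lemma pairing_mx (p : 'cV[R]_d) u : pairing p^T u = (u *m p) 0 0.
Proof. by rewrite mxE; apply: eq_bigr => i _; rewrite mxE mulrC. Qed.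

(** A generator of a simplicial cone spans a one-dimensional face, which is a cone of the fan and so
    one of the listed rays. *)
Lemma simplicial_row sigma m (B : 'M[R]_(m, d)) j : Sigma sigma -> row_free B ->
  sigma = cone (range (fun i => row i B)) -> (row j B <= map_mx intr nu)%MS.
Proof.
move=> sS fB; rewrite cone_range_row => sE.
have [C BC] := row_freeP fB.
(* The linear form with value 0 on row [j] of [B] and 1 on the other rows; it cuts out the face of
   row [j]. *)
pose p : 'cV[R]_d := C *m \col_i (i != j)%:R.
have pE b : pairing p^T (b *m B) = \sum_i b 0 i * (i != j)%:R.
  rewrite pairing_mx -mulmxA /p (mulmxA B) BC mul1mx mxE.
  by apply: eq_bigr => i _; rewrite mxE.
pose tau := sigma `&` [set u | pairing p^T u = 0].
have ts : face tau sigma.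
  exists p^T; split=> // u; rewrite sE => -[b [b0 _ ->]].
  by rewrite pE sumr_ge0 // => i _; rewrite mulr_ge0 ?ler0n.
have tauj : tau (row j B).
  split; first by rewrite sE; exact: pos_span_row.
  rewrite /= rowE pE big1 // => i _; rewrite mxE eqxx /=.
  by case: eqP => _; rewrite ?mulr0 ?mul0r.
have tau1 : cone_dim tau = 1%N.
  apply/eqP; rewrite eqn_leq; apply/andP; split.
    apply: leq_trans (rank_leq_row (row j B)); apply: cone_dim_le => x [].
    rewrite sE => -[b [b0 _ ->]] /= /eqP; rewrite pE psumr_eq0; last first.
      by move=> i _; rewrite mulr_ge0 ?ler0n.
    move=> /allP bj; rewrite mulmx_sum_row; apply: summx_sub => i _.
    have := bj i (mem_index_enum _) => /=; have [->|ij] := eqVneq i j.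
      by rewrite scalemx_sub.
    by rewrite mulr1 => /eqP ->; rewrite scale0r sub0mx.
  apply: (@cone_dim_ge _ _ _ 1 (row j B)); last first.
    by move=> i; rewrite ord1 row_id.
  apply: inj_row_free => v vB; have : (v *m delta_mx 0 j) *m B = 0 *m B.
    by rewrite -mulmxA -rowE mul0mx.
  move=> /(row_free_inj fB)/rowP/(_ j); rewrite !mxE big_ord1 mxE !eqxx mulr1.
  by move=> v0; apply/rowP => i; rewrite ord1 mxE.
have [_ _ _ + _] := fan_Sigma => /(_ _ _ sS ts) tS.
have [_ _ rays] := rays_Sigma; have [i tauE] := (rays tau).1 (conj tS tau1).
move: tauj; rewrite tauE => -[l [c [v [_ vi ->]]]].
apply: summx_sub => s _; rewrite (vi s) scalemx_sub //.
by rewrite /toR map_row row_sub.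
Qed.

Lemma rays_span : full_dim_convex_support Sigma -> row_free (deltaR nu R).
Proof.
case=> _ dimS; rewrite /row_free /deltaR mxrank_tr.
apply/eqP/anti_leq; rewrite rank_leq_col /= -{1}dimS.
apply: cone_dim_le => x [sigma sS]; have [m [B [fB sE]]] := simplicial_Sigma sS.
rewrite {1}sE cone_range_row => -[b [_ _ ->]].
rewrite mulmx_sum_row; apply: summx_sub => i _; rewrite scalemx_sub //.
exact: simplicial_row sS fB sE.
Qed.

End Rays.

(** * Relevance and weight cones *)

Section Degrees.
Variables (k : closedFieldType) (R : realType) (n d : nat).
Variable nu : 'M[int]_(n, d).
Implicit Types (I J : {set 'I_n}) (chi : Cl nu).

Local Notation D := (deltaR nu R).
Local Notation G := (col_base (cokermx D)).
Local Notation r := (rankCl nu R).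

Lemma beta_row i : beta nu R i = row i G.
Proof.
rewrite /beta tensor1_gamma rowE /gammaR; congr (_ *m _).
by apply/rowP => j; rewrite !mxE; case: (_ && _).
Qed.

Lemma Cbeta_pos_span : Cbeta nu R = pos_span G [set: 'I_n].
Proof.
rewrite -cone_range_row /Cbeta; suff -> : beta nu R = fun i => row i G by [].
by apply/funext => i; exact: beta_row.
Qed.

(** An independent [I] with fewer than [r] elements spans a cone of too small dimension. Conversely,
    a cone on degrees that contains the class contains, by [pos_span_indep], an independent set of
    generators, which has [r] elements. *)
Lemma generic_vecP chi : generic R chi <->
  Cbeta nu R (tensor1 R chi) /\ generic_vec G (tensor1 R chi).
Proof.
have Gfull : row_full G by exact: col_base_full.
split=> -[chiC gchi]; split=> //.
  move=> I iI Ichi; apply/eqP; rewrite eqn_leq (indep_card iI) /=.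
  pose A := [set row i G | i in [set` I]].
  have AI : A `<=` pos_span G I by move=> _ [i iI' <-]; exact: pos_span_row.
  have cA : cone A = pos_span G I.
    apply/seteqP; split; first exact: cone_sub_pos_span.
    by apply: pos_span_sub_cone => i iI'; exists i.
  have rC : (r <= cone_dim (Cbeta nu R))%N.
    apply: (cone_dim_ge (fullrowsub_free Gfull)) => i.
    rewrite Cbeta_pos_span (_ : row i _ = row (fullrankfun Gfull i) G).
      exact: pos_span_row.
    by apply/rowP => j; rewrite !mxE.
  rewrite leqNgt; apply/negP => Ir; apply: (gchi A); last by rewrite cA.
    by move=> _ [i _ <-]; exists i => //; rewrite beta_row.
  apply: leq_trans rC; apply: leq_ltn_trans Ir.
  apply: leq_trans (rank_leq_row (subconf G I)).
  by apply: cone_dim_le => x; rewrite cA; exact: pos_span_submx.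
move=> A AC dA Achi.
pose J : {set 'I_n} := [set i | `[< A (row i G) >]]%SET.
have AJ : A `<=` pos_span G J.
  move=> x Ax; have [i _ ix] := AC x Ax.
  rewrite -ix beta_row; apply: pos_span_row; rewrite inE; apply/asboolP.
  by rewrite -beta_row ix.
have [I [IJ iI Ichi]] := pos_span_indep (cone_sub_pos_span AJ Achi).
suff : (r <= cone_dim (cone A))%N.
  apply/negP; rewrite -ltnNge; apply: (leq_trans dA).
  apply: leq_trans (rank_leq_col G); apply: cone_dim_le => x.
  by rewrite Cbeta_pos_span => -[b [_ _ ->]]; exact: submxMl.
rewrite -[X in (X <= _)%N](gchi I iI Ichi).
apply: (cone_dim_ge (B := subconf G I)) => [|l]; first exact/indepP.
have /(fintype.subsetP IJ) : enum_val l \in I by exact: enum_valP.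
rewrite inE => /asboolP Al; exists 1%N, (fun=> 1), (fun=> row l (subconf G I)).
split=> // [_|]; last by rewrite big_ord1 scale1r.
by rewrite (_ : row l _ = row (enum_val l) G) //; apply/rowP => j; rewrite !mxE.
Qed.

Lemma tensor1_mondeg (m : multinom n) :
  tensor1 R (mondeg nu m) = (\row_i (m i)%:R) *m G.
Proof.
rewrite /mondeg tensor1_gamma /gammaR; congr (_ *m _).
by apply/rowP => i; rewrite !mxE.
Qed.

(** Divisors of powers of the monomial have leading exponents supported on [I], and each variable of
    [I] is a divisor; the resulting cone is already closed. *)
Lemma weight_cone_xset I : indep G I -> #|I| = r ->
  weight_cone nu R (xset k I) = pos_span G I.
Proof.
move=> iI cI; rewrite /weight_cone.
set A := [set v | _]; suff -> : cone A = pos_span G I.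
  by apply/esym/closure_id; exact: closed_pos_span.
apply/seteqP; split.
  apply: cone_sub_pos_span => _ [g [h [e [c [gh cg ->]]]]].
  have [g0 h0 ghI] := xset_divisor gh.
  rewrite (homog_deg g0 cg) -[gamma nu _]/(mondeg nu _) tensor1_mondeg.
  exists (\row_i (mlead g i)%:R); split=> // [i|]; first by rewrite mxE ler0n.
  apply/suppP => i iI'; rewrite mxE.
  have := ghI i; rewrite (negPf iI') mul0n => /eqP.
  by rewrite addn_eq0 => /andP[/eqP ->].
apply: pos_span_sub_cone => i iI'.
exists (x_ k i), (xset k (I :\ i)), 1%N, (mondeg nu (mnm1 i)); split.
- by rewrite expr1 /xset (big_setD1 i).
- exact: homogX.
- rewrite tensor1_mondeg rowE; congr (_ *m _).
  by apply/rowP => j; rewrite !mxE eqxx /= mnm1E eq_sym.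
Qed.

(** Finite index gives every class a positive multiple in the subgroup generated by the degrees in
    [I]. These [r] degrees therefore span, hence are independent. *)
Lemma indep_of_relevant I : #|I| = r -> relevant nu (xset k I) -> indep G I.
Proof.
move=> cI [_ _ [s sP]].
have mult (a : 'rV[int]_n) : exists (N : nat) (z : 'rV[int]_n),
    [/\ (0 < N)%N, forall i, i \notin I -> z 0 i = 0
      & gamma nu (a *+ N) = gamma nu z].
  have /choice[g gP] : forall e : nat, exists c, c \in s /\
      unit_degrees (xset k I) (gamma nu (a *+ e) - c).
    by move=> e; have [c cs Hc] := sP (gamma nu (a *+ e)); exists c.
  have gs e : (index (g e) s < size s)%N by rewrite index_mem; case: (gP e).
  (* Pigeonhole: among [size s + 1] multiples of [a], two share a coset representative. *)
  pose f (e : 'I_(size s).+1) := Ordinal (gs e).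
  have /existsNP[e1 /existsNP[e2 /not_implyP[/(congr1 val) /= fe ne]]] :
      ~ injective f.
    by move=> /leq_card; rewrite !card_ord ltnn.
  wlog lt12 : e1 e2 fe ne / (e1 < e2)%N.
    move=> W; have [||e12] := ltngtP e1 e2; first exact: W fe ne.
      by apply: (W e2 e1) => // e21; apply: ne.
    by case: ne; apply: val_inj.
  have g12 : g e1 = g e2.
    by rewrite -(nth_index (g e1) (gP e1).1) fe nth_index ?(gP e2).1.
  have [_ /unit_degrees_xset[z1 [z1I z1E]]] := gP e1.
  have [_ /unit_degrees_xset[z2 [z2I z2E]]] := gP e2.
  exists (e2 - e1)%N, (z2 - z1); split; first by rewrite subn_gt0.
    by move=> i iI; rewrite !mxE z1I // z2I // subrr.
  rewrite gammaB -z1E -z2E g12 opprB addrA subrK -gammaB mulrnBr //.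
  exact: ltnW.
apply/indepP; suff : row_full (subconf G I).
  by move=> /eqP rI; apply/eqP; rewrite rI; exact: esym cI.
rewrite -sub1mx; have /row_fullP[C CG] : row_full G by exact: col_base_full.
rewrite -CG; apply: (submx_trans (submxMl _ _)); apply/row_subP => j.
have [N [z [N0 zI zE]]] := mult (delta_mx 0 j).
have NR : (N%:R : R) != 0 by rewrite pnatr_eq0 -lt0n.
have supz : supp (toR R z) \subset I.
  by apply/suppP => i /zI; rewrite mxE => ->.
suff -> : row j G = N%:R^-1 *: (toR R z *m G).
  by rewrite (subconfP G supz) scalemx_sub // submxMl.
apply: (canRL (scalerK NR)); rewrite -[RHS]/(gammaR nu _) -tensor1_gamma -zE.
rewrite tensor1_gamma rowE scalemxAl /gammaR; congr (_ *m _).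
apply/rowP => i; rewrite !mxE mulmxnE mxE.
case: (_ && _) => /=; last by rewrite mulr0 mul0rn.
by rewrite mulr1n mulr1 mulrz_nat.
Qed.

(** By Gale duality the rays outside [I] form a basis, of determinant [N]; then [N] times any class
    is a unit degree, and classes modulo [N] are finite in number. *)
Lemma relevant_of_indep I : row_free D -> #|I| = r -> indep G I ->
  relevant nu (xset k I).
Proof.
move=> D_free cI iI; split; first exact: xset_neq0.
  by exists (mondeg nu (mset I)); rewrite xsetE; exact: homogX.
have cT : #|~: I| = d.
  have dn : (d <= n)%N by rewrite -(eqP D_free) rank_leq_col.
  rewrite cardsCs finset.setCK card_ord cI /rankCl mxrank_coker (eqP D_free).
  by rewrite subKn.
pose f (l : 'I_d) : 'I_n := enum_val (cast_ord (esym cT) l).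
have fS i : i \notin I -> exists l, f l = i.
  move=> iI'; have iT : i \in ~: I by rewrite inE.
  exists (cast_ord cT (enum_rank_in iT i)).
  by rewrite /f cast_ordK enum_rankK_in.
pose M : 'M[int]_d := \matrix_(l, j) nu (f j) l.
have deltaM m j : delta nu m 0 (f j) = (m *m M) 0 j.
  by rewrite !mxE; apply: eq_bigr => l _; rewrite !mxE.
pose N := \det M.
have N0 : N != 0.
  rewrite -(intr_eq0 R) -det_map_mx -unitfE -unitmxE -row_free_unit.
  apply: inj_row_free => m mM; apply: (row_free_inj D_free).
  rewrite mul0mx; apply: iI; last by apply/gammaR_eq0; exists m.
  apply/suppP => i /fS[l <-]; have /rowP/(_ l) := mM.
  rewrite [RHS]mxE => mMl; rewrite -[RHS]mMl [LHS]mxE [RHS]mxE.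
  by apply: eq_bigr => j _; rewrite !mxE.
have HN (a : 'rV[int]_n) : unit_degrees (xset k I) (gamma nu (N *: a)).
  (* Cramer's rule: [delta nu m] agrees with [N *: a] outside [I]. *)
  pose m := (\row_j a 0 (f j)) *m \adj M.
  apply/unit_degrees_xset; exists (N *: a - delta nu m); split.
    move=> i /fS[l <-]; rewrite mxE [X in _ + X]mxE deltaM -mulmxA mul_adj_mx.
    by rewrite mul_mx_scalar !mxE subrr.
  by apply/gamma_eq; exists m; rewrite opprB addrC subrK.
exists [seq gamma nu (\row_i (g i : nat)%:Z) | g : {ffun 'I_n -> 'I_(absz N)}].
move=> c; have [a <-] := gamma_surj c.
have modN i : leq (absz (modz (a 0 i) N)).+1 (absz N).
  by rewrite -ltz_nat gez0_abs ?modz_ge0 // ltz_mod.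
exists (gamma nu (\row_i modz (a 0 i) N)).
  apply/mapP; exists [ffun i => Ordinal (modN i)]; first by rewrite mem_enum.
  congr gamma; apply/rowP => i.
  by rewrite !mxE ffunE /= gez0_abs ?modz_ge0.
suff -> : gamma nu a - gamma nu (\row_i modz (a 0 i) N) =
    gamma nu (N *: \row_i divz (a 0 i) N) by exact: HN.
rewrite -gammaB; congr gamma; apply/rowP => i; rewrite !mxE.
by rewrite [in LHS](divz_eq (a 0 i) N) modzMDl modz_mod addrK mulrC.
Qed.

End Degrees.

(** * Chambers *)

Section Chambers.
Variables (k : closedFieldType) (R : realType) (n d : nat).
Variable nu : 'M[int]_(n, d).
Implicit Types (I J : {set 'I_n}) (a : 'rV[int]_n).

Local Notation D := (deltaR nu R).
Local Notation G := (col_base (cokermx D)).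
Local Notation r := (rankCl nu R).
Local Notation wt a := (tensor1 R (gamma nu a)).

Hypothesis D_free : row_free D.

Lemma Gen_weight_cone w :
  Gen nu k R `&` [set f | weight_cone nu R f w] = @xset k n @` bases G w.
Proof.
apply/seteqP; split=> [f [[rf [I [cI fE]]] /=]|_ [I [iI cI Iw] <-]].
  rewrite fE in rf *; have iI := indep_of_relevant cI rf.
  by rewrite weight_cone_xset // => Iw; exists I.
split; last by rewrite /= weight_cone_xset.
by split; [exact: (relevant_of_indep k D_free cI iI) | exists I].
Qed.

(** A point of the fibre on the facets of [I] is one supported on the complement of [I], whose
    monomial is the generator. *)
Lemma irrelevant_generators a :
  [set p | exists I, (P_chi R (gamma nu a) `&`
      \bigcap_(i in [set` I]) F_chi R i (gamma nu a)) !=set0 /\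
    p = \prod_(i in ~: I) x_ k i] =
  @xset k n @` [set J | pos_span G J (wt a)].
Proof.
apply/seteqP; split=> p.
  move=> [I [[b [[b0 bw] bF]] ->]].
  exists (~: I) => //; exists b; split=> //.
  by apply/suppP => i; rewrite inE negbK => /bF[].
move=> [J [b [b0 /suppP bJ wb]] <-]; exists (~: J).
split; last by rewrite finset.setCK.
exists b; split; first by split.
by move=> i /=; rewrite inE => /bJ bi; split.
Qed.

Lemma GKZ_generic a : Cbeta nu R (wt a) -> generic_vec G (wt a) ->
  GKZ (normal_fan (P_ nu a)) (I_empty nu R a) =
  [set y | forall I, bases G (wt a) I -> pos_span G I y].
Proof.
rewrite Cbeta_pos_span => -[b [b0 _ bw]] gw; apply/seteqP; split.
  move=> y ya I [iI cI [b' [b'0 b'I b'w]]].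
  rewrite -(generic_supp gw iI b'0 b'I (esym b'w)).
  have [m b'E] : exists m, b' = toR R a + m *m D.
    by apply: gammaR_fibre; rewrite -tensor1_gamma b'w.
  move: ya; rewrite b'E; apply: GKZ_sub => //; rewrite -?b'E.
    by apply/P_nonneg; rewrite -b'E.
  exact: indepS b'I iI.
rewrite tensor1_gamma; apply: (GKZ_sup b0); rewrite -tensor1_gamma //.
Qed.

(** [GKZ_sub] confines the GKZ cone to the cone of each vertex support, so full dimension forces
    these supports to have [r] elements. *)
Lemma generic_of_chamber a :
  cone_dim (@GKZ n d nu R (normal_fan (P_ nu a)) (I_empty nu R a)) = r ->
  generic_vec G (wt a).
Proof.
move=> dimG I iI [b [b0 bI bw]].
have [m bE] : exists m, b = toR R a + m *m D.
  by apply: gammaR_fibre; rewrite -tensor1_gamma bw.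
have sI : @GKZ n d nu R (normal_fan (P_ nu a)) (I_empty nu R a) `<=`
    pos_span G (supp b).
  rewrite bE; apply: GKZ_sub => //; rewrite -?bE; last exact: indepS bI iI.
  by apply/P_nonneg; rewrite -bE.
apply/eqP; rewrite eqn_leq (indep_card iI) /= -[X in (X <= _)%N]dimG.
apply: leq_trans (subset_leq_card bI).
apply: leq_trans (rank_leq_row (subconf G (supp b))).
by apply: cone_dim_le => x /sI; exact: pos_span_submx.
Qed.

Lemma generic_irrelevantP a : Cbeta nu R (wt a) ->
  generic R (gamma nu a) <-> B_ k R (gamma nu a) =
    ideal_gen (Gen nu k R `&` [set f | weight_cone nu R f (wt a)]).
Proof.
move=> aC; rewrite generic_vecP Gen_weight_cone /B_ irrelevant_generators.
split=> [[_ gw]|eqI].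
  apply/seteqP; split; apply: ideal_gen_sub => _ [J Jw <-].
    have [I [IJ iI Iw]] := pos_span_indep Jw.
    exists (xset k (J :\: I)), (xset k I); split; last exact: xset_sub.
    by exists I => //; split=> //; exact: gw.
  exists 1, (xset k J); rewrite mul1r; split=> //; exists J => //.
  by case: Jw.
split=> // J iJ Jw; apply/eqP; rewrite eqn_leq (indep_card iJ) /=.
(* As [x^J] lies in [B(chi)], some [x^I] with [I] a basis divides it, so [J] has at least [r]
   elements. *)
have [|I [_ cI _] IJ] := @xset_ideal k n (bases G (wt a)) J; last first.
  by rewrite -[X in (X <= _)%N]cI; exact: subset_leq_card.
rewrite -eqI; exists 1%N, (fun=> 1), (fun=> xset k J).
by split=> [_|]; [exists J | rewrite big_ord1 mul1r].
Qed.

Lemma chamber_genericP a (sigma : set 'rV[R]_r) :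
  Cbeta nu R (wt a) -> generic R (gamma nu a) ->
  (chamber nu sigma /\ sigma (wt a)) <->
  sigma = \bigcap_(f in Gen nu k R `&` [set f | weight_cone nu R f (wt a)])
            weight_cone nu R f.
Proof.
move=> aC /generic_vecP[_ gw]; rewrite Gen_weight_cone bigcap_image.
have -> : \bigcap_(I in bases G (wt a)) weight_cone nu R (xset k I) =
    [set y | forall I, bases G (wt a) I -> pos_span G I y].
  apply/seteqP; split=> y yI I Iw; have := yI I Iw; have [iI cI _] := Iw;
    by rewrite weight_cone_xset.
split=> [[[[a' [a'C ->]] /generic_of_chamber gw']]|->].
  rewrite GKZ_generic // => aa'.
  have [b' [b'0 _ b'w]] : pos_span G [set: 'I_n] (wt a').
    by rewrite -Cbeta_pos_span.
  (* A chamber depends only on the bases. That the class of [a] lies in the GKZ cone of [a'] gives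
     one inclusion directly, and the other through [bases_sub]. *)
  suff -> : bases G (wt a) = bases G (wt a') by [].
  apply/seteqP; split; first exact: (bases_sub gw gw' b'0 (esym b'w)).
  by move=> I Ia'; case: (Ia') => iI cI _; split=> //; exact: aa'.
split; last by move=> I [].
split; first by exists a; split=> //; rewrite GKZ_generic.
apply/eqP; rewrite eqn_leq; apply/andP; split.
  apply: leq_trans (rank_leq_row (1%:M : 'M[R]_r)).
  by apply: cone_dim_le => x _; exact: submx1.
have [X [fX XI]] := bases_interior gw.
exact: (cone_dim_ge fX).
Qed.

End Chambers.

Theorem theorem2
  (k : closedFieldType) (char_k : [pchar k] =i pred0)
  (R : realType) (d n : nat)
  (Sigma : set (set 'rV[R]_d)) (nu : 'M[int]_(n, d))
  (fan_Sigma : is_fan Sigma)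
  (rays_Sigma : ray_generators Sigma nu)
  (simplicial_Sigma : simplicial Sigma)
  (support_Sigma : full_dim_convex_support Sigma)
  (quasiprojective_Sigma : quasiprojective Sigma)
  (a : 'rV[int]_n) (a_Cbeta : Cbeta nu R (tensor1 R (gamma nu a))) :
  (generic R (gamma nu a) <->
   B_ k R (gamma nu a) =
   ideal_gen (Gen nu k R `&`
              [set f | weight_cone nu R f (tensor1 R (gamma nu a))])) /\
  (generic R (gamma nu a) ->
   forall sigma : set 'rV[R]_(rankCl nu R),
     (chamber nu sigma /\ sigma (tensor1 R (gamma nu a))) <->
     sigma = \bigcap_(f in Gen nu k R `&`
                [set f | weight_cone nu R f (tensor1 R (gamma nu a))])
                weight_cone nu R f).
Proof.
have D_free := rays_span fan_Sigma rays_Sigma simplicial_Sigma support_Sigma.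
split; first exact: generic_irrelevantP.
by move=> gen_a sigma; exact: chamber_genericP.
Qed.
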